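(* (Buchberger's criterion) Let $X$ be a set, $\preccurlyeq$ be a monomial order on the free algebra $\mathcal{A}(X)$, and $I$ be an ideal of $\mathcal{A}(X)$. A subset $\mathcal{G}$ of $I$ is a Gröbner basis for $(I,\preccurlyeq)$ if, and only if, the $1$-polygraph $\mathrm{Lead}(\mathcal{G})$ is critically confluent.
   Context: Fix a field $\mathbb{K}$; algebras are unital associative $\mathbb{K}$-algebras; $\mathcal{A}(S)$ is the free algebra on a set $S$, with linear basis the free monoid $S^*$, whose elements are called monomials; $\mathrm{supp}(a)$ is the set of monomials with nonzero coefficient in $a$. A monomial order on $\mathcal{A}(S)$ is a wellfounded total order $\preccurlyeq$ on $S^*$ whose strict part is stable by product ($u\succ u'$ implies $vuw\succ vu'w$). For a nonzero $a\in\mathcal{A}(S)$, $\mathrm{lm}(a)$ is the $\preccurlyeq$-maximum of $\mathrm{supp}(a)$ and $\mathrm{lc}(a)$ is its coefficient in $a$; $\mathrm{lm}(0)=0$. A Gröbner basis for $(I,\preccurlyeq)$ is a subset $\mathcal{G}$ of $I$ such that the ideals of $\mathcal{A}(S)$ generated by $\mathrm{lm}(I)$ and by $\mathrm{lm}(\mathcal{G})$ coincide. A $1$-polygraph $P=\langle P_0\,|\,P_1\rangle$ is a set $P_0$ and a set $P_1$ (of $1$-cells) with two maps $s,t:P_1\to\mathcal{A}(P_0)$. It is left-monomial if each $s(\alpha)$ is a monomial not in $\mathrm{supp}(t(\alpha))$. $\mathrm{Lead}(\mathcal{G})$ is the (left-monomial) $1$-polygraph with set of $0$-cells $X$ and one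 $1$-cell $\alpha_a$ with source $\mathrm{lm}(a)$ and target $\mathrm{lm}(a)-\frac{1}{\mathrm{lc}(a)}a$ for each $a\in\mathcal{G}$. The free $1$-algebra $\mathcal{A}(P)$ of a left-monomial $1$-polygraph $P$ has as $0$-cells the elements of $\mathcal{A}(P_0)$; its $1$-cells are the elements of the quotient of the $\mathcal{A}(P_0)$-bimodule $(\mathcal{A}(P_0)\otimes\mathbb{K}P_1\otimes\mathcal{A}(P_0))\oplus\mathcal{A}(P_0)$ by the sub-bimodule generated by the elements $(a s(b)+t(a)b-t(a)s(b))-(s(a)b+a t(b)-s(a)t(b))$ for $a,b$ in the first summand, where $s(a\alpha b)=a s(\alpha) b$, $t(a\alpha b)=a t(\alpha) b$, and an element $c$ of the second summand is the identity $1_c$. Composition of $f:a\to b$ and $g:b\to c$ is $f\star_0 g=f-1_b+g$. A $1$-monomial is a $1$-cell $u\alpha v$ with $u,v$ monomials, $\alpha\in P_1$. A rewriting step is a $1$-cell $\lambda f+1_a$ with $f$ a $1$-monomial, $\lambda\neq0$ a scalar and $s(f)\notin\mathrm{supp}(a)$; a positive $1$-cell is a (possibly empty) composite of rewriting steps; a branching is a pair $(f,g)$ of positive $1$-cells with the same source ($(f,g)$ and $(g,f)$ are not distinguished); it is confluent if there are positive $1$-cells $h,k$ with $s(h)=t(f)$, $s(k)=t(g)$, $t(h)=t(k)$. A critical branching is a pair $(f,g)$ of $1$-monomials with the same source such that: $f\neq g$; $(f,g)$ is not, up to order, of the form $(f'v,ug')$ with $f':u\to a$, $g':v\to b$ $1$-monomials;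 and $(f,g)$ cannot be written $(uf'v,ug'v)$ with $(f',g')$ a branching and $u,v$ monomials not both equal to $1$. $P$ is critically confluent if every critical branching is confluent.
   Formalization: The ''if'' direction additionally assumes that G generates the ideal I (it fails otherwise, e.g. G empty and I nonzero); Lead(G) has one 1-cell for each nonzero element of G only, since lc(0) is not invertible. *)

(* Defs.v *)
From HB Require Import structures.
From mathcomp Require Import all_boot all_algebra.
From mathcomp Require Import finmap.
From mathcomp Require Import boolp classical_sets.
From mathcomp.multinomials Require Import monalg.

Set Implicit Arguments.
Unset Strict Implicit.
Unset Printing Implicit Defensive.

Import GRing.Theory.

Local Open Scope quotient_scope.
Local Open Scope ring_scope.
Local Open Scope classical_set_scope.

Notation freealg K X := {malg K[{fmonom X}]}.

(* The linear map sending each basis element << k >> to h k.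
   Locking, here and below, only keeps conversion from unfolding finitely
   supported functions; it carries no mathematical content. *)
HB.lock Definition linext (K : fieldType) (T : choiceType) (V : lmodType K)
    (h : T -> V) (x : {malg K[T]}) : V :=
  \sum_(k <- msupp x) x@_k *: h k.

Section LinearExtension.
Context (K : fieldType) (T : choiceType) (V : lmodType K).

Lemma linextEw (h : T -> V) (x : {malg K[T]}) (d : {fset T}) :
  (msupp x `<=` d)%fset -> linext h x = \sum_(k <- d) x@_k *: h k.
Proof.
move=> le_xd; rewrite linext.unlock; apply/big_fset_incl => // k _ kx.
by rewrite mcoeff_outdom // scale0r.
Qed.

Lemma linext_is_linear (h : T -> V) : linear (linext h).
Proof.
move=> c x y; pose d := (msupp x `|` msupp y)%fset.
have le_d: (msupp (c *: x + y)%R `<=` d)%fset.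
  apply: fsubset_trans (msuppD_le _ _) _.
  by apply: fsetSU; apply: msuppZ_le.
rewrite (linextEw _ le_d) (linextEw _ (fsubsetUl _ _ : _ `<=` d)%fset).
rewrite (linextEw _ (fsubsetUr _ _ : msupp y `<=` d)%fset).
rewrite scaler_sumr -big_split /=; apply: eq_bigr => k _.
by rewrite mcoeffD mcoeffZ scalerDl scalerA.
Qed.

HB.instance Definition _ h :=
  GRing.isLinear.Build K {malg K[T]} V *:%R (linext h) (linext_is_linear h).

Lemma linextU (h : T -> V) k : linext h << k >> = h k.
Proof. by rewrite linext.unlock msuppU oner_eq0 big_seq_fset1 mcoeffUU scale1r. Qed.

Lemma linextUZ (h : T -> V) c k : linext h << c *g k >> = c *: h k.
Proof. by rewrite (linextEw _ msuppU_le) big_seq_fset1 mcoeffUU. Qed.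

Lemma eq_linext (h h' : T -> V) x : h =1 h' -> linext h x = linext h' x.
Proof. by move=> hh'; rewrite linext.unlock; apply: eq_bigr => k _; rewrite hh'. Qed.

Lemma linextZ c (h : T -> V) x : linext (fun k => c *: h k) x = c *: linext h x.
Proof.
by rewrite linext.unlock scaler_sumr; apply: eq_bigr => k _; rewrite !scalerA mulrC.
Qed.

End LinearExtension.

Lemma linext_comp (K : fieldType) (T : choiceType) (V W : lmodType K)
    (f : {linear V -> W}) (h : T -> V) x :
  f (linext h x) = linext (fun k => f (h k)) x.
Proof. by rewrite linext.unlock linear_sum; apply: eq_bigr => k _; rewrite linearZ. Qed.

Lemma linext_id (K : fieldType) (T : choiceType) (x : {malg K[T]}) :
  linext (fun k => << k >>) x = x.
Proof.
rewrite linext.unlock [RHS]monalgE; apply: eq_bigr => m _.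
by apply/malgP => k; rewrite mcoeffZ !mcoeffU mulrnAr mulr1.
Qed.

Section FreeAlgebra.
Context (K : fieldType) (X : choiceType).
Local Notation A := (freealg K X).
Implicit Types (a b x : A) (c : K).

Lemma freealg_scaleAr c a b : a * (c *: b) = c *: (a * b).
Proof.
have le_cb: (msupp (c *: b) `<=` msupp b)%fset by exact: msuppZ_le.
apply/malgP => k; rewrite (mcoeffMlw k (fsubset_refl (msupp a)) le_cb).
rewrite mcoeffZ (mcoeffMl a b) mulr_sumr.
apply: eq_bigr => m _; rewrite mulr_sumr; apply: eq_bigr => n _.
by rewrite mcoeffZ mulrnAr mulrCA.
Qed.

Lemma freealgUM (m n : {fmonom X}) :
  << mmul m n >> = << m >> * << n >> :> A.
Proof. by rewrite malgME !msuppU1 !big_seq_fset1 !mcoeffUU mulr1. Qed.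

Lemma freealg_mull (T : choiceType) (h : T -> A) a (x : {malg K[T]}) :
  a * linext h x = linext (fun k => a * h k) x.
Proof.
by rewrite linext.unlock mulr_sumr; apply: eq_bigr => k _; rewrite freealg_scaleAr.
Qed.

Lemma freealg_mulr (T : choiceType) (h : T -> A) a (x : {malg K[T]}) :
  linext h x * a = linext (fun k => h k * a) x.
Proof. by rewrite linext.unlock mulr_suml; apply: eq_bigr => k _; rewrite -scalerAl. Qed.

Definition is_ideal (I : set A) : Prop :=
  [/\ I 0,
      forall x y, I x -> I y -> I (x - y),
      forall a x, I x -> I (a * x) &
      forall a x, I x -> I (x * a)].

Definition ideal_gen (S : set A) : set A := smallest is_ideal S.

Definition strict (le : rel {fmonom X}) : rel {fmonom X} :=
  fun u v => (u != v) && le u v.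

Record is_monomial_order (le : rel {fmonom X}) : Prop := IsMonomialOrder {
  mo_refl : reflexive le;
  mo_anti : antisymmetric le;
  mo_trans : transitive le;
  mo_total : total le;
  mo_wf : well_founded (fun u v => strict le u v);
  mo_mul : forall u u' v w, strict le u' u ->
    strict le (mmul (mmul v u') w) (mmul (mmul v u) w) }.

(* The last element of the support sorted by [le] is its maximum; the default
   value [mone] is only reached at 0, where [lm] and [lc] vanish. *)
Definition lmon (le : rel {fmonom X}) (a : A) : {fmonom X} :=
  last mone (sort le (msupp a)).

Definition lm (le : rel {fmonom X}) (a : A) : A :=
  if a == 0 then 0 else << lmon le a >>.

Definition lc (le : rel {fmonom X}) (a : A) : K := a@_(lmon le a).

Definition is_groebner_basis (le : rel {fmonom X}) (I G : set A) : Prop :=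
  G `<=` I /\ ideal_gen (lm le @` I) = ideal_gen (lm le @` G).

Lemma lmon_msupp le a : a != 0 -> lmon le a \in msupp a.
Proof.
move=> a0; rewrite -(mem_sort le) /lmon.
have: sort le (msupp a) != [::].
  rewrite -size_eq0 size_sort size_eq0; apply: contra a0 => /eqP sa.
  rewrite -msupp_eq0; apply/eqP/fsetP => k.
  by rewrite -[k \in _]/(k \in enum_fset (msupp a)) sa in_fset0.
by case: (sort _ _) => //= x s _; apply: mem_last.
Qed.

Lemma lc_neq0 le a : a != 0 -> lc le a != 0.
Proof. by move=> a0; rewrite mcoeff_neq0 lmon_msupp. Qed.

End FreeAlgebra.

Record polygraph (K : fieldType) := Polygraph {
  cells0 : choiceType;
  cells1 : choiceType;
  psrc : cells1 -> freealg K cells0;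
  ptgt : cells1 -> freealg K cells0 }.

Definition left_monomial (K : fieldType) (P : polygraph K) : Prop :=
  forall al : cells1 P, exists2 m, psrc al = << m >> & m \notin msupp (ptgt al).

(* The bimodule A (x) K P_1 (x) A is free over K on the triples (u, al, v),
   which stand for u (x) al (x) v. *)
Definition bimod (K : fieldType) (P : polygraph K) :=
  {malg K[({fmonom (cells0 P)} * cells1 P * {fmonom (cells0 P)})%type]}.
HB.instance Definition _ K P := GRing.Lmodule.on (@bimod K P).

HB.lock Definition bimodU (K : fieldType) (P : polygraph K)
    (u : {fmonom (cells0 P)}) (al : cells1 P) (v : {fmonom (cells0 P)}) :
  bimod P := << (u, al, v) >>.

(* The bimodule morphism u (x) al (x) v |-> u * phi al * v *)
HB.lock Definition bimod_ext (K : fieldType) (P : polygraph K)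
    (phi : cells1 P -> freealg K (cells0 P)) (x : bimod P) : freealg K (cells0 P) :=
  linext (fun k => << k.1.1 >> * phi k.1.2 * << k.2 >>) x.

Section FreeBimodule.
Context (K : fieldType) (P : polygraph K).
Local Notation M := {fmonom (cells0 P)}.
Local Notation A := (freealg K (cells0 P)).
Local Notation bimod := (bimod P).

Definition bimodl (a : A) (x : bimod) : bimod :=
  linext (fun k : M * cells1 P * M =>
    linext (fun m => bimodU (mmul m k.1.1) k.1.2 k.2) a) x.

Definition bimodr (x : bimod) (b : A) : bimod :=
  linext (fun k : M * cells1 P * M =>
    linext (fun m => bimodU k.1.1 k.1.2 (mmul k.2 m)) b) x.

Lemma bimodl_is_linear a : linear (bimodl a).
Proof. exact: linext_is_linear. Qed.

HB.instance Definition _ a :=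
  GRing.isLinear.Build K bimod bimod *:%R (bimodl a) (bimodl_is_linear a).

Lemma bimodrB b x y : bimodr (x - y) b = bimodr x b - bimodr y b.
Proof. exact: linearB. Qed.

Lemma bimodlC c x : bimodl c%:MP x = c *: x.
Proof.
rewrite /bimodl -[in RHS](linext_id x) -linextZ; apply: eq_linext => -[[u al] v].
by rewrite linextUZ mul1m bimodU.unlock.
Qed.

Lemma bimod_ext_is_linear phi : linear (@bimod_ext K P phi).
Proof. by rewrite bimod_ext.unlock; apply: linext_is_linear. Qed.

HB.instance Definition _ phi :=
  GRing.isLinear.Build K bimod A *:%R (@bimod_ext K P phi) (bimod_ext_is_linear phi).

Lemma bimod_extD (phi : cells1 P -> A) x y :
  bimod_ext phi (x + y) = bimod_ext phi x + bimod_ext phi y.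
Proof. exact: linearD. Qed.

Lemma bimod_extU (phi : cells1 P -> A) u al v :
  bimod_ext phi (bimodU u al v) = << u >> * phi al * << v >>.
Proof. by rewrite bimodU.unlock bimod_ext.unlock; apply: linextU. Qed.

Lemma bimod_extl (phi : cells1 P -> A) a x : bimod_ext phi (bimodl a x) = a * bimod_ext phi x.
Proof.
rewrite linext_comp [in RHS]bimod_ext.unlock freealg_mull; apply: eq_linext => -[[u al] v].
rewrite (linext_comp (bimod_ext phi)) -[in RHS](linext_id a) freealg_mulr.
by apply: eq_linext => m; rewrite [LHS]bimod_extU freealgUM !mulrA.
Qed.

Lemma bimod_extr (phi : cells1 P -> A) b x : bimod_ext phi (bimodr x b) = bimod_ext phi x * b.
Proof.
rewrite linext_comp [in RHS]bimod_ext.unlock freealg_mulr; apply: eq_linext => -[[u al] v].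
rewrite (linext_comp (bimod_ext phi)) -[in RHS](linext_id b) freealg_mull.
apply: eq_linext => m; rewrite [LHS]bimod_extU freealgUM; exact: mulrA.
Qed.

Definition precell := (bimod * A)%type.
HB.instance Definition _ := GRing.Lmodule.on precell.

Definition prel (a : A) (x : precell) : precell := (bimodl a x.1, a * x.2).
Definition prer (x : precell) (b : A) : precell := (bimodr x.1 b, x.2 * b).
Definition pre_ext (phi : cells1 P -> A) (x : precell) : A :=
  bimod_ext phi x.1 + x.2.

Lemma prelB a x y : prel a (x - y) = prel a x - prel a y.
Proof. by rewrite /prel /= linearB mulrBr. Qed.

Lemma prerB b x y : prer (x - y) b = prer x b - prer y b.
Proof. by rewrite /prer /= bimodrB mulrBl. Qed.

Lemma prelC c x : prel c%:MP x = c *: x.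
Proof. by rewrite /prel bimodlC mul_malgC. Qed.

Lemma pre_extB phi x y : pre_ext phi (x - y) = pre_ext phi x - pre_ext phi y.
Proof. by rewrite /pre_ext /= linearB /= opprD addrACA. Qed.

Lemma pre_extD phi x y : pre_ext phi (x + y) = pre_ext phi x + pre_ext phi y.
Proof. by rewrite /pre_ext bimod_extD addrACA. Qed.

End FreeBimodule.

HB.lock Definition inB (K : fieldType) (P : polygraph K) (x : bimod P) :
  precell P := (x, 0).
HB.lock Definition inA (K : fieldType) (P : polygraph K)
  (c : freealg K (cells0 P)) : precell P := (0, c).

Section FreeOneAlgebra.
Context (K : fieldType) (P : polygraph K).
Local Notation M := {fmonom (cells0 P)}.
Local Notation A := (freealg K (cells0 P)).
Local Notation bimod := (bimod P).
Local Notation precell := (precell P).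

(* The difference of the two sides of the interchange relation. *)
Definition interchange (a b : bimod) : precell :=
  let s := bimod_ext (@psrc K P) in
  let t := bimod_ext (@ptgt K P) in
  (inB (bimodr a (s b)) + inB (bimodl (t a) b) - inA (t a * s b)) -
  (inB (bimodl (s a) b) + inB (bimodr a (t b)) - inA (s a * t b)).

Definition is_subbimod (N : set precell) : Prop :=
  [/\ N 0,
      forall x y, N x -> N y -> N (x - y),
      forall a x, N x -> N (prel a x) &
      forall a x, N x -> N (prer x a)].

Definition interchange_sub : set precell :=
  smallest is_subbimod [set interchange a b | a in setT & b in setT].

Lemma interchange_subP : is_subbimod interchange_sub.
Proof.
split=> [|x y Nx Ny|a x Nx|a x Nx] N NP; case: (NP) => -[N0 NB Nl Nr] _.
- exact: N0.
- by apply: NB; [apply: Nx | apply: Ny].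
- by apply: Nl; apply: Nx.
- by apply: Nr; apply: Nx.
Qed.

Definition interchange_pred : {pred precell} := fun x => `[< interchange_sub x >].

Lemma interchange_zmod_closed : zmod_closed interchange_pred.
Proof.
have [N0 NB _ _] := interchange_subP.
split=> [|x y /asboolP Nx /asboolP Ny]; apply/asboolP => //.
exact: NB.
Qed.

HB.instance Definition _ :=
  GRing.isZmodClosed.Build precell interchange_pred interchange_zmod_closed.

(* The 1-cells of the free 1-algebra on P: the quotient of the bimodule precell
   by the sub-bimodule generated by the interchange relations. *)
Definition cell := @Quotient.quot precell interchange_pred.
HB.instance Definition _ := Choice.on cell.
HB.instance Definition _ := EqQuotient.on cell.
HB.instance Definition _ := GRing.Zmodule.on cell.
HB.instance Definition _ := ZmodQuotient.on cell.

Lemma cell_eqP (x y : precell) :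
  reflect (\pi_cell x = \pi_cell y) `[< interchange_sub (x - y) >].
Proof. by rewrite -[asbool _]/((x - y) \in interchange_pred) Quotient.idealrBE; apply: eqP. Qed.

Lemma pre_ext_inB (phi : cells1 P -> A) x : pre_ext phi (inB x) = bimod_ext phi x.
Proof. by rewrite inB.unlock; apply: addr0. Qed.

Lemma pre_ext_inA (phi : cells1 P -> A) c : pre_ext phi (inA c) = c.
Proof. by rewrite inA.unlock /pre_ext (linear0 (bimod_ext phi)) add0r. Qed.

Lemma pre_ext_interchange (phi : cells1 P -> A) a b :
  (phi = @psrc K P \/ phi = @ptgt K P) -> pre_ext phi (interchange a b) = 0.
Proof.
have E (p q p' q' : bimod) (c c' : A) :
    pre_ext phi ((inB p + inB q - inA c) - (inB p' + inB q' - inA c')) =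
    (bimod_ext phi p + bimod_ext phi q - c) -
    (bimod_ext phi p' + bimod_ext phi q' - c').
  by rewrite 3!pre_extB 2!pre_extD 4!pre_ext_inB 2!pre_ext_inA.
move=> phiP; rewrite /interchange E !bimod_extl !bimod_extr; case: phiP => ->.
  have alg (x y z : A) : (x + y - y) - (x + z - z) = 0 by rewrite !addrK subrr.
  exact: alg.
have alg (x y z : A) : (y + x - y) - (z + x - z) = 0.
  by rewrite ![_ + x]addrC !addrK subrr.
exact: alg.
Qed.

Lemma pre_ext_sub (phi : cells1 P -> A) x :
  (phi = @psrc K P \/ phi = @ptgt K P) -> interchange_sub x -> pre_ext phi x = 0.
Proof.
move=> phiP Nx; apply: (Nx [set y | pre_ext phi y = 0]); split; last first.
  by move=> _ [a _ [b _ <-]]; apply: pre_ext_interchange.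
split=> [|y z /= y0 z0|a y /= y0|a y /= y0].
- by rewrite /= /pre_ext (linear0 (bimod_ext phi)) addr0.
- by rewrite /= pre_extB y0 z0 subrr.
- by rewrite /pre_ext bimod_extl -mulrDr -/(pre_ext phi y) y0 mulr0.
- by rewrite /pre_ext bimod_extr -mulrDl -/(pre_ext phi y) y0 mul0r.
Qed.

(* These are well defined on classes, see cell_srcE, cell_tgtE, celllE, cellrE
   and cellZE below. *)
Definition cell_src (f : cell) : A := pre_ext (@psrc K P) (repr f).
Definition cell_tgt (f : cell) : A := pre_ext (@ptgt K P) (repr f).
Definition celll (a : A) (f : cell) : cell := \pi_cell (prel a (repr f)).
Definition cellr (f : cell) (b : A) : cell := \pi_cell (prer (repr f) b).
Definition cellZ (c : K) (f : cell) : cell := \pi_cell (c *: repr f).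

Lemma cell_reprP x : interchange_sub (repr (\pi_cell x) - x).
Proof. by apply/asboolP/cell_eqP; rewrite reprK. Qed.

Lemma cell_srcE x : cell_src (\pi_cell x) = pre_ext (@psrc K P) x.
Proof.
by apply/eqP; rewrite -subr_eq0 -pre_extB pre_ext_sub //;
  [left | apply: cell_reprP].
Qed.

Lemma cell_tgtE x : cell_tgt (\pi_cell x) = pre_ext (@ptgt K P) x.
Proof.
by apply/eqP; rewrite -subr_eq0 -pre_extB pre_ext_sub //;
  [right | apply: cell_reprP].
Qed.

Lemma celllE a x : celll a (\pi_cell x) = \pi_cell (prel a x).
Proof.
have [_ _ Nl _] := interchange_subP.
by apply/cell_eqP/asboolP; rewrite -prelB; apply: Nl; apply: cell_reprP.
Qed.

Lemma cellrE b x : cellr (\pi_cell x) b = \pi_cell (prer x b).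
Proof.
have [_ _ _ Nr] := interchange_subP.
by apply/cell_eqP/asboolP; rewrite -prerB; apply: Nr; apply: cell_reprP.
Qed.

Lemma cellZE c x : cellZ c (\pi_cell x) = \pi_cell (c *: x).
Proof. by rewrite -prelC -celllE /cellZ -prelC. Qed.

Lemma cellP (f : cell) : exists x, f = \pi_cell x.
Proof. by exists (repr f); rewrite reprK. Qed.

Lemma cell_piD x y : \pi_cell (x + y) = \pi_cell x + \pi_cell y.
Proof. by rewrite !piE. Qed.

Lemma cellZA c d f : cellZ c (cellZ d f) = cellZ (c * d) f.
Proof. by have [x ->] := cellP f; rewrite !cellZE scalerA. Qed.

Lemma cellZ1 f : cellZ 1 f = f.
Proof. by have [x ->] := cellP f; rewrite cellZE scale1r. Qed.

Lemma cellZDr c f g : cellZ c (f + g) = cellZ c f + cellZ c g.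
Proof.
have [x ->] := cellP f; have [y ->] := cellP g.
by rewrite -cell_piD !cellZE scalerDr cell_piD.
Qed.

Lemma cellZDl f c d : cellZ (c + d) f = cellZ c f + cellZ d f.
Proof. by have [x ->] := cellP f; rewrite !cellZE scalerDl cell_piD. Qed.

HB.instance Definition _ :=
  GRing.Zmodule_isLmodule.Build K cell cellZA cellZ1 cellZDr cellZDl.

Definition id_cell (a : A) : cell := \pi_cell (inA a).

Definition monomial_cell (u : M) (al : cells1 P) (v : M) : cell :=
  \pi_cell (inB (bimodU u al v)).

(* The composite f *_0 g, meaningful when cell_tgt f = cell_src g *)
Definition cell_comp (f g : cell) : cell := f - id_cell (cell_tgt f) + g.

Lemma cell_src_monomial u al v :
  cell_src (monomial_cell u al v) = << u >> * psrc al * << v >>.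
Proof. by rewrite cell_srcE pre_ext_inB bimod_extU. Qed.

Lemma cell_tgt_monomial u al v :
  cell_tgt (monomial_cell u al v) = << u >> * ptgt al * << v >>.
Proof. by rewrite cell_tgtE pre_ext_inB bimod_extU. Qed.

Lemma cell_src_id a : cell_src (id_cell a) = a.
Proof. by rewrite cell_srcE pre_ext_inA. Qed.

Lemma cell_tgt_id a : cell_tgt (id_cell a) = a.
Proof. by rewrite cell_tgtE pre_ext_inA. Qed.

Definition is_1monomial (f : cell) : Prop := exists u al v, f = monomial_cell u al v.

Definition is_rewriting_step (F : cell) : Prop :=
  exists c f a m,
    [/\ F = c *: f + id_cell a, is_1monomial f, c != 0,
        cell_src f = << m >> & m \notin msupp a].

Inductive positive : cell -> Prop :=
| positive_id a : positive (id_cell a)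
| positive_comp f g : is_rewriting_step f -> positive g ->
    cell_tgt f = cell_src g -> positive (cell_comp f g).

Definition is_branching (f g : cell) : Prop :=
  [/\ positive f, positive g & cell_src f = cell_src g].

Definition confluent (f g : cell) : Prop :=
  exists h k, [/\ positive h, positive k, cell_src h = cell_tgt f,
    cell_src k = cell_tgt g & cell_tgt h = cell_tgt k].

(* The pairs (f'v, ug') with f' : u -> a and g' : v -> b. *)
Definition is_peiffer (f g : cell) : Prop :=
  exists f' g', [/\ is_1monomial f', is_1monomial g',
    f = cellr f' (cell_src g') & g = celll (cell_src f') g'].

Definition whisker (u : M) (f : cell) (v : M) : cell :=
  celll << u >> (cellr f << v >>).

Definition is_critical_branching (f g : cell) : Prop :=
  [/\ is_1monomial f /\ is_1monomial g, cell_src f = cell_src g, f <> g,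
      ~ (is_peiffer f g \/ is_peiffer g f) &
      ~ exists u v f' g', [/\ ~ (u = mone /\ v = mone), is_branching f' g',
          f = whisker u f' v & g = whisker u g' v]].

Definition critically_confluent : Prop :=
  forall f g, is_critical_branching f g -> confluent f g.

End FreeOneAlgebra.

(* The 1-cells are indexed by the nonzero elements of G: lm 0 = 0 is not a
   monomial and lc 0 = 0 is not invertible, so 0 yields no rewriting rule. *)
Definition Lead (K : fieldType) (X : choiceType) (le : rel {fmonom X})
    (G : set (freealg K X)) : polygraph K :=
  @Polygraph K X (set_type (G `\` [set 0]))
    (fun a => lm le (val a))
    (fun a => lm le (val a) - (lc le (val a))^-1 *: val a).

Lemma Lead_left_monomial (K : fieldType) (X : choiceType)
    (le : rel {fmonom X}) (G : set (freealg K X)) :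
  left_monomial (Lead le G).
Proof.
case=> a aG; have /eqP a0 : a <> 0 by move/set_mem: aG => -[].
exists (lmon le a); rewrite /= /lm (negPf a0) // -mcoeff_eq0.
by rewrite mcoeffB mcoeffUU mcoeffZ mulVf ?subrr // lc_neq0.
Qed.

(* Main.v *)
From HB Require Import structures.
Require Import Defs.
From mathcomp Require Import all_boot all_algebra.
From mathcomp Require Import finmap.
From mathcomp Require Import boolp classical_sets.
From mathcomp.multinomials Require Import monalg.

Set Implicit Arguments.
Unset Strict Implicit.
Unset Printing Implicit Defensive.

Import GRing.Theory.

Local Open Scope ring_scope.
Local Open Scope classical_set_scope.

(** Work with a polygraph whose rules [psrc al -> ptgt al] replace a word
    [lead al] by a combination of strictly smaller words, and call a word
    reducible when it contains some [lead al].  Both implications compare the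
    rewriting relation with the ideal of the rules, through one criterion
    ([groebner_basisP]): [G] is a Groebner basis of [I] exactly when every
    nonzero element of [I] has a leading monomial divisible by that of a nonzero
    element of [G], because a word lies in an ideal generated by words only when
    it is a multiple of one of them ([monomial_ideal]).

    From a Groebner basis to confluence. Two elements [x] and [y] congruent
    modulo the ideal always reduce to a common element ([joinable_ideal]). Let
    [m] be the largest word occurring in [x] or [y]. If [m] is reducible,
    rewriting it in both makes everything smaller. If it is not, [m] has the
    same coefficient in [x] and in [y], since otherwise [m] would be the
    leading monomial of [x - y]; this common term is set aside and the tails
    are joined. The targets of a branching are congruent.

    From critical confluence to a Groebner basis. The key is that two one-step
    reductions of the same word [m] differ by a combination of rules applied
    to words strictly below [m] ([local_span]), which is proved by induction
    on the length of [m] along the definition of a critical branching. A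
    Peiffer pair contributes products of one rule with the small target of the
    other; a whiskered branching comes from a shorter word; a confluent
    branching is closed by two reduction paths, each of whose steps acts below
    [m]. A nonzero element [x] of the ideal generated by [G] is a combination
    of rules in context; take the least [m] bounding the redexes of such a
    combination. By [local_span] all the terms acting on [m] itself may be
    merged into a single one, modulo smaller terms ([span_le_split]). Its
    coefficient is nonzero by minimality, so [m] survives as the leading
    monomial of [x], and it is reducible ([span_lmon]). *)

(** * Identities in abstract modules and rings *)

Lemma subr_shift (V : zmodType) (a b c d : V) :
  c - d = (a - b) - ((a - c) - (b - d)).
Proof. by rewrite opprB [RHS]addrA [a - b + _]addrA subrK opprB addrC addrA subrK. Qed.

Lemma addr_telescope (V : zmodType) (a b c d : V) :
  (a - b) + (b + c - d) = a + c - d.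
Proof. by rewrite 2!addrA subrK. Qed.

Lemma subrBB (V : zmodType) (a b c : V) : (a - c) - (b - c) = a - b.
Proof. by rewrite opprB addrA subrK. Qed.

(** With [s - t] and [s' - t'] two rules, the two orders of rewriting a product
    [s * s'] differ by multiples of the rules by targets only. *)
Lemma peiffer_identity (R : pzRingType) (s s' t t' : R) :
  t * s' - s * t' = t * (s' - t') - (s - t) * t'.
Proof. by rewrite mulrBr mulrBl opprB addrA subrK. Qed.

(** Merges two rules with the same source [m] at the cost of the difference of
    their targets. *)
Lemma scaler_split (R : pzRingType) (V : lmodType R) (c d : R) (m t t' y : V) :
  c *: (m - t) + (d *: (m - t') + y) = (c + d) *: (m - t) + (d *: (t - t') + y).
Proof.
by rewrite scalerDl -addrA; congr (_ + _); rewrite addrA -scalerDr addrA subrK.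
Qed.

Lemma scale_tail (K : fieldType) (V : lmodType K) (c : K) (m x : V) :
  c != 0 -> m - c^-1 *: x = - c^-1 *: (x - c *: m).
Proof. by move=> c0; rewrite scaleNr scalerBr opprB scalerA mulVf // scale1r. Qed.

Lemma mulr_nested (R : pzRingType) (a b x c d : R) :
  a * (b * x * c) * d = (a * b) * x * (c * d).
Proof. by rewrite !mulrA. Qed.

(** * Words and elements in a two-sided context *)

Section Words.
Context (X : choiceType).
Implicit Types (u v k : {fmonom X}).

Definition ins u v k : {fmonom X} := mmul (mmul u k) v.

Lemma ins_inj u v : injective (ins u v).
Proof.
move=> k k' /(congr1 (@fmonom_val X)); rewrite !fmM => kk'.
have /eqP := congr1 size kk'; rewrite !size_cat eqn_add2r eqn_add2l => /eqP skk'.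
move/eqP: kk'; rewrite !eqseq_cat ?size_cat ?skk' // eqxx /= => /andP[/eqP kk' _].
by apply/eqP; rewrite fmP kk'.
Qed.

Lemma ins_ins u v u' v' k : ins u v (ins u' v' k) = ins (mmul u u') (mmul v' v) k.
Proof. by rewrite /ins !mulmA. Qed.

Lemma ins1 k : ins mone mone k = k.
Proof. by rewrite /ins mul1m mulm1. Qed.

Lemma insl u k : ins u mone k = mmul u k.
Proof. by rewrite /ins mulm1. Qed.

Lemma insr v k : ins mone v k = mmul k v.
Proof. by rewrite /ins mul1m. Qed.

Lemma fdeg_ins_lt u v k : ~ (u = mone /\ v = mone) -> (fdeg k < fdeg (ins u v k))%N.
Proof.
move=> uv1; rewrite !fdegM addnAC -[X in (X < _)%N]add0n ltn_add2r.
rewrite lt0n addn_eq0 !fdeg_eq0; apply/andP => -[/eqP u1 /eqP v1].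
by apply: uv1.
Qed.

End Words.

(** The linear extension of [ins u v].  The lock keeps unification from
    unfolding products of finitely supported functions. *)
HB.lock Definition ctx (K : fieldType) (X : choiceType) (u v : {fmonom X})
  (x : freealg K X) : freealg K X := << u >> * x * << v >>.

Section Support.
Context (K : fieldType) (X : choiceType).
Local Notation A := (freealg K X).
Local Notation M := {fmonom X}.
Implicit Types (x y a b : A) (k u v : M) (D : M -> Prop).

Definition supported D x := forall k, x@_k != 0 -> D k.

Lemma supportedW D D' x : (forall k, D k -> D' k) -> supported D x -> supported D' x.
Proof. by move=> DD' Dx k /Dx/DD'. Qed.

Lemma supported0 D : supported D 0.
Proof. by move=> k; rewrite mcoeff0 eqxx. Qed.

Lemma supportedD D x y : supported D x -> supported D y -> supported D (x + y).
Proof.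
move=> Dx Dy k; rewrite mcoeffD; have [->|/Dx //] := eqVneq x@_k 0.
by rewrite add0r => /Dy.
Qed.

Lemma supportedZ D c x : supported D x -> supported D (c *: x).
Proof. by move=> Dx k; rewrite mcoeffZ mulf_eq0 negb_or => /andP[_ /Dx]. Qed.

Lemma supportedB D x y : supported D x -> supported D y -> supported D (x - y).
Proof. by move=> Dx Dy; rewrite -scaleN1r; apply: supportedD => //; apply: supportedZ. Qed.

Lemma supportedU D k : D k -> supported D << k >>.
Proof. by move=> Dk k'; rewrite mcoeffU1; case: (k =P k') => [<-|]; rewrite ?eqxx. Qed.

Lemma supported_linext D (h : M -> A) x :
  (forall k, supported D (h k)) -> supported D (linext h x).
Proof.
move=> Dh; rewrite linext.unlock; apply: big_ind.
- exact: supported0.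
- exact: supportedD.
- by move=> k _; apply: supportedZ.
Qed.

Lemma ctxE u v x : ctx u v x = << u >> * x * << v >>.
Proof. by rewrite ctx.unlock. Qed.

Lemma ctx_is_linear u v : linear (@ctx K X u v).
Proof.
move=> c x y; rewrite !ctxE mulrDr mulrDl freealg_scaleAr.
by rewrite -scalerAl.
Qed.

HB.instance Definition _ u v :=
  GRing.isLinear.Build K A A *:%R (@ctx K X u v) (ctx_is_linear u v).

Lemma ctxU u v k : ctx u v << k >> = << ins u v k >> :> A.
Proof. by rewrite ctxE -!freealgUM. Qed.

Lemma ctx_ctx u v u' v' x : ctx u v (ctx u' v' x) = ctx (mmul u u') (mmul v' v) x.
Proof. by rewrite !ctxE (freealgUM K u u') (freealgUM K v' v); apply: mulr_nested. Qed.

Lemma ctxl u x : ctx u mone x = << u >> * x.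
Proof. by rewrite ctxE; apply: mulr1. Qed.

Lemma ctxr v x : ctx mone v x = x * << v >>.
Proof. by rewrite ctxE -[X in _ = X * _]mul1r. Qed.

Lemma ctx_linext u v x : ctx u v x = linext (fun k => << ins u v k >>) x.
Proof.
rewrite -[in LHS](linext_id x) linext_comp.
by apply: eq_linext => k /=; rewrite ctxU.
Qed.

Lemma mcoeff_ctx u v x k : (ctx u v x)@_(ins u v k) = x@_k.
Proof.
rewrite ctx_linext linext.unlock raddf_sum /=.
rewrite (eq_bigr (fun j => x@_j *+ (j == k))).
  rewrite -[RHS](congr1 (mcoeff k) (linext_id x)) linext.unlock raddf_sum.
  by apply: eq_bigr => j _ /=; rewrite mcoeffZ mcoeffU1 mulr_natr.
by move=> j _; rewrite mcoeffZ mcoeffU1 mulr_natr (inj_eq (@ins_inj _ u v)).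
Qed.

Lemma supported_ctx D D' u v x : (forall k, D k -> D' (ins u v k)) ->
  supported D x -> supported D' (ctx u v x).
Proof.
move=> DD' Dx k; rewrite ctx_linext linext.unlock raddf_sum /= => sum0.
have /hasP[j _]: has (fun j => (x@_j *: << ins u v j >>)@_k != 0) (msupp x).
  apply: contraR sum0 => /hasPn all0; rewrite big_seq big1 // => j xj.
  by apply/eqP; rewrite -[_ == _]negbK all0.
rewrite mcoeffZ mulf_eq0 negb_or mcoeffU1 => /andP[/Dx/DD' Dj].
by case: (_ =P k) => [<-|]; rewrite ?eqxx.
Qed.

(** Since [ins u v] is injective, [ctx u v] transports coefficients without
    mixing them, so an element can be read off its image. *)
Lemma ctx_eqU u v x k : ctx u v x = << k >> ->
  exists2 k', k = ins u v k' & x = << k' >>.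
Proof.
move=> xk; have xE j : x@_j = (k == ins u v j)%:R.
  by rewrite -(mcoeff_ctx u v x) xk mcoeffU1.
have [[j kj]|nk] := pselect (exists j, k = ins u v j).
  exists j => //; apply/malgP => i; rewrite xE kj mcoeffU1.
  by rewrite (inj_eq (@ins_inj _ u v)).
have x0 : x = 0.
  apply/malgP => j; rewrite xE mcoeff0.
  by case: eqP => // kj; case: nk; exists j.
move: xk => /(congr1 (mcoeff k)); rewrite x0 linear0 mcoeff0 mcoeffUU.
by move=> /eqP; rewrite eq_sym oner_eq0.
Qed.

Lemma monomial_inj : injective (fun k => << k >> : A).
Proof.
move=> k k' /(congr1 (mcoeff k)); rewrite mcoeffUU mcoeffU1.
by case: eqP => // _ /eqP; rewrite oner_eq0.
Qed.

Lemma leading_decomp m x :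
  x = x@_m *: << m >> + (x - x@_m *: << m >>).
Proof. by rewrite addrC subrK. Qed.

End Support.

(** * Supports and the monomial order *)

Section Order.
Context (K : fieldType) (X : choiceType) (le : rel {fmonom X}).
Hypothesis leP : is_monomial_order le.
Local Notation A := (freealg K X).
Local Notation M := {fmonom X}.
Implicit Types (x y a : A) (k u v : M) (D : M -> Prop).
Local Notation lt := (strict le).

Definition below m x := supported (lt^~ m) x.

Lemma lt_irr m : lt m m = false.
Proof. by rewrite /strict eqxx. Qed.

Lemma lt_le m n : lt m n -> le m n.
Proof. by case/andP. Qed.

Lemma le_eqlt m n : le m n -> m = n \/ lt m n.
Proof. by rewrite /strict => ->; have [->|] := eqVneq m n; [left|right]. Qed.

Lemma le_lt_trans n m p : le m n -> lt n p -> lt m p.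
Proof.
move=> mn /andP[np lenp]; rewrite /strict (mo_trans leP mn lenp) andbT.
apply: contra np => /eqP mp; rewrite mp in mn.
by apply/eqP/(mo_anti leP); rewrite lenp mn.
Qed.

Lemma lt_trans n m p : lt m n -> lt n p -> lt m p.
Proof. by move=> /lt_le; apply: le_lt_trans. Qed.

Lemma lt_ins u v m n : lt m n -> lt (ins u v m) (ins u v n).
Proof. exact: (mo_mul leP). Qed.

Lemma seq_max (s : seq M) :
  s = [::] \/ exists2 m, m \in s & {in s, forall k, le k m}.
Proof.
elim: s => [|k s IH]; [by left|right].
case: IH => [->|[m ms mmax]].
  by exists k; rewrite ?mem_head // => j; rewrite inE => /eqP->; apply: (mo_refl leP).
case/orP: (mo_total leP k m) => [km|mk].
  exists m; first by rewrite inE ms orbT.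
  by move=> j; rewrite inE => /predU1P[->|/mmax].
exists k; first exact: mem_head.
move=> j; rewrite inE => /predU1P[->|/mmax jm]; first exact: (mo_refl leP).
exact: (mo_trans leP jm mk).
Qed.

(** Supplies the word on which the well-founded inductions run.  It occurs in one
    of the two elements, so it inherits any strict bound on their supports. *)
Lemma supported_max x y : x = 0 /\ y = 0 \/
  exists2 m, x@_m != 0 \/ y@_m != 0 &
    supported (le^~ m) x /\ supported (le^~ m) y.
Proof.
have mem k : (k \in msupp x ++ msupp y) = (x@_k != 0) || (y@_k != 0).
  by rewrite mem_cat !mcoeff_neq0.
have [s0|[m]] := seq_max (msupp x ++ msupp y).
  left; split; apply/malgP => k; rewrite mcoeff0; apply/eqP; move: (mem k);
  by rewrite s0 in_nil => /esym/negbT; rewrite negb_or !negbK => /andP[].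
rewrite mem => /orP mxy mmax; right; exists m => //.
by split=> k xk; apply: mmax; rewrite mem xk ?orbT.
Qed.

Lemma le_lmon x k : x@_k != 0 -> le k (lmon le x).
Proof.
move=> xk; have : k \in sort le (msupp x) by rewrite mem_sort -mcoeff_neq0.
have := sort_sorted (mo_total leP) (msupp x).
rewrite (sorted_pairwise (mo_trans leP)) /lmon.
elim/last_ind: (sort _ _) => // s m _; rewrite pairwise_rcons => /andP[/allP sm _].
rewrite mem_rcons inE last_rcons => /predU1P[->|/sm //]; exact: (mo_refl leP).
Qed.

Lemma lmon_eq x m : x@_m != 0 -> supported (le^~ m) x -> lmon le x = m.
Proof.
move=> xm xlem; have x0 : x != 0 by apply: contraNneq xm => ->; rewrite mcoeff0.
apply: (mo_anti leP); rewrite le_lmon // andbT; apply: xlem.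
by rewrite mcoeff_neq0 lmon_msupp.
Qed.

Lemma below_tail m x : supported (le^~ m) x -> below m (x - x@_m *: << m >>).
Proof.
move=> xm k; have [->|nkm] := eqVneq k m.
  by rewrite mcoeffB mcoeffZ mcoeffUU mulr1 subrr eqxx.
rewrite mcoeffB mcoeffZ mcoeffU1 [m == k]eq_sym (negPf nkm) mulr0 subr0 => /xm km.
by rewrite /strict nkm.
Qed.

Lemma below_coeff m x : below m x -> x@_m = 0.
Proof. by move=> xm; apply/eqP; apply: contraFT (lt_irr m) => /xm. Qed.

Lemma below_ctx m u v x : below m x -> below (ins u v m) (ctx u v x).
Proof. by apply: supported_ctx => k; apply: lt_ins. Qed.

Lemma below_le m n x : below m x -> le m n -> below n x.
Proof.
move=> xm mn k /xm km; case: (le_eqlt mn) => [<- //|]; exact: lt_trans.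
Qed.

End Order.

(** * Sources and targets of cells *)

Section Cells.
Context (K : fieldType) (P : polygraph K).
Local Notation A := (freealg K (cells0 P)).
Implicit Types (f g : cell P) (a b : A).

Lemma pre_extZ (phi : cells1 P -> A) c (x : precell P) :
  pre_ext phi (c *: x) = c *: pre_ext phi x.
Proof. by rewrite /pre_ext scalerDr -linearZ. Qed.

Lemma cell_srcD f g : cell_src (f + g) = cell_src f + cell_src g.
Proof.
have [x ->] := cellP f; have [y ->] := cellP g.
by rewrite -cell_piD !cell_srcE pre_extD.
Qed.

Lemma cell_tgtD f g : cell_tgt (f + g) = cell_tgt f + cell_tgt g.
Proof.
have [x ->] := cellP f; have [y ->] := cellP g.
by rewrite -cell_piD !cell_tgtE pre_extD.
Qed.

Lemma cell_srcZ c f : cell_src (c *: f) = c *: cell_src f.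
Proof.
have [x ->] := cellP f; rewrite -[c *: _]/(cellZ c _) cellZE !cell_srcE.
exact: pre_extZ.
Qed.

Lemma cell_tgtZ c f : cell_tgt (c *: f) = c *: cell_tgt f.
Proof.
have [x ->] := cellP f; rewrite -[c *: _]/(cellZ c _) cellZE !cell_tgtE.
exact: pre_extZ.
Qed.

Lemma cell_src_l a f : cell_src (celll a f) = a * cell_src f.
Proof.
have [x ->] := cellP f; rewrite celllE !cell_srcE /pre_ext bimod_extl.
by rewrite -mulrDr.
Qed.

Lemma cell_tgt_l a f : cell_tgt (celll a f) = a * cell_tgt f.
Proof.
have [x ->] := cellP f; rewrite celllE !cell_tgtE /pre_ext bimod_extl.
by rewrite -mulrDr.
Qed.

Lemma cell_src_r f b : cell_src (cellr f b) = cell_src f * b.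
Proof.
have [x ->] := cellP f; rewrite cellrE !cell_srcE /pre_ext bimod_extr.
by rewrite -mulrDl.
Qed.

Lemma cell_tgt_r f b : cell_tgt (cellr f b) = cell_tgt f * b.
Proof.
have [x ->] := cellP f; rewrite cellrE !cell_tgtE /pre_ext bimod_extr.
by rewrite -mulrDl.
Qed.

Lemma cell_src_whisker u f v : cell_src (whisker u f v) = ctx u v (cell_src f).
Proof. by rewrite cell_src_l cell_src_r ctxE; apply: mulrA. Qed.

Lemma cell_tgt_whisker u f v : cell_tgt (whisker u f v) = ctx u v (cell_tgt f).
Proof. by rewrite cell_tgt_l cell_tgt_r ctxE; apply: mulrA. Qed.

Lemma cell_src_comp f g :
  cell_tgt f = cell_src g -> cell_src (cell_comp f g) = cell_src f.
Proof.
move=> fg; rewrite /cell_comp -scaleN1r !cell_srcD cell_srcZ cell_src_id fg.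
by rewrite scaleN1r subrK.
Qed.

Lemma cell_tgt_comp f g : cell_tgt (cell_comp f g) = cell_tgt g.
Proof.
rewrite /cell_comp -scaleN1r !cell_tgtD cell_tgtZ cell_tgt_id.
by rewrite scaleN1r subrr add0r.
Qed.

(** A rewriting path, forgotten down to its endpoints: this is all that
    confluence of a branching depends on. *)
Definition reduces a b :=
  exists f, [/\ positive f, cell_src f = a & cell_tgt f = b].

Lemma reduces_refl a : reduces a a.
Proof.
by exists (id_cell a); split; [left | apply: cell_src_id | apply: cell_tgt_id].
Qed.

Lemma confluentE f g :
  confluent f g <-> exists2 z, reduces (cell_tgt f) z & reduces (cell_tgt g) z.
Proof.
split=> [[h [k [hp kp hf kg hk]]]|[z [h [hp hs ht]] [k [kp ks kt]]]].
  by exists (cell_tgt h); [exists h | exists k].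
by exists h, k; split=> //; rewrite ht kt.
Qed.

End Cells.

(** * Rewriting with oriented rules *)

Section Oriented.
Context (K : fieldType) (P : polygraph K).
Local Notation A := (freealg K (cells0 P)).
Local Notation M := {fmonom (cells0 P)}.
Context (le : rel M) (lead : cells1 P -> M).
Hypothesis leP : is_monomial_order le.
Hypothesis leadE : forall al, psrc al = << lead al >>.
Hypothesis tgt_below : forall al, below le (lead al) (ptgt al).
Local Notation lt := (strict le).
Implicit Types (x y z a b : A) (m u v : M) (al be : cells1 P).

Definition reducible m := exists u al v, m = ins u v (lead al).

Definition rule u al v : A := ctx u v (psrc al - ptgt al).

Lemma cell_src_monomialE u al v :
  cell_src (monomial_cell u al v) = << ins u v (lead al) >>.
Proof. by rewrite cell_src_monomial -ctxE leadE ctxU. Qed.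

Lemma cell_tgt_monomialE u al v :
  cell_tgt (monomial_cell u al v) = ctx u v (ptgt al).
Proof. by rewrite cell_tgt_monomial -ctxE. Qed.

Lemma ruleE u al v :
  rule u al v = << ins u v (lead al) >> - ctx u v (ptgt al).
Proof. by rewrite /rule linearB /= leadE ctxU. Qed.

Lemma cell_src_step c u al v a :
  cell_src (c *: monomial_cell u al v + id_cell a) =
  c *: << ins u v (lead al) >> + a.
Proof.
rewrite (cell_srcD (c *: monomial_cell u al v) (id_cell a)) cell_srcZ.
by rewrite cell_src_id cell_src_monomialE.
Qed.

Lemma cell_tgt_step c u al v a :
  cell_tgt (c *: monomial_cell u al v + id_cell a) =
  c *: ctx u v (ptgt al) + a.
Proof.
rewrite (cell_tgtD (c *: monomial_cell u al v) (id_cell a)) cell_tgtZ.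
by rewrite cell_tgt_id cell_tgt_monomialE.
Qed.

Lemma reduces_step u al v c a z : (ins u v (lead al)) \notin msupp a ->
  reduces (c *: ctx u v (ptgt al) + a) z ->
  reduces (c *: << ins u v (lead al) >> + a) z.
Proof.
have [->|c0] := eqVneq c 0; first by rewrite !scale0r.
move=> mNa [g [gp gs gt]].
have Fg : cell_tgt (c *: monomial_cell u al v + id_cell a) = cell_src g.
  by rewrite cell_tgt_step gs.
exists (cell_comp (c *: monomial_cell u al v + id_cell a) g); split.
- right=> //; exists c, (monomial_cell u al v), a, (ins u v (lead al)).
  by split=> //; [exists u, al, v | apply: cell_src_monomialE].
- by apply: etrans (cell_src_comp Fg) _; apply: cell_src_step.
- by apply: etrans (cell_tgt_comp _ _) _.
Qed.

Lemma rewriting_stepP F : is_rewriting_step F ->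
  exists c u al v a, [/\ c != 0, ins u v (lead al) \notin msupp a,
    cell_src F = c *: << ins u v (lead al) >> + a &
    cell_tgt F = c *: ctx u v (ptgt al) + a].
Proof.
move=> [c [_ [a [m [-> [u [al [v ->]]] c0]]]]].
rewrite cell_src_monomialE => /monomial_inj <- mNa.
exists c, u, al, v, a.
by split=> //; [apply: cell_src_step | apply: cell_tgt_step].
Qed.

(** Lets proofs about paths handle only the endpoints of a first step, without
    manipulating cells of the quotient. *)
Lemma reduces_ind (Q : A -> A -> Prop) : (forall x, Q x x) ->
  (forall c u al v a z, c != 0 -> ins u v (lead al) \notin msupp a ->
    reduces (c *: ctx u v (ptgt al) + a) z ->
    Q (c *: ctx u v (ptgt al) + a) z ->
    Q (c *: << ins u v (lead al) >> + a) z) ->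
  forall x y, reduces x y -> Q x y.
Proof.
move=> Qid Qstep x y [f [fp <- <-]] {x y}.
elim: fp => [a|F g /rewriting_stepP[c [u [al [v [a [c0 mNa Fs Ft]]]]]] gp IH Fg].
  by rewrite cell_src_id cell_tgt_id; apply: Qid.
rewrite cell_src_comp // cell_tgt_comp Fs.
by apply: Qstep => //; rewrite -Ft Fg //; exists g.
Qed.

Lemma below_redex c m a : c != 0 -> m \notin msupp a ->
  forall n, below le n (c *: << m >> + a) -> lt m n /\ below le n a.
Proof.
move=> c0 mNa n mac; have cm : lt m n.
  apply: mac; rewrite mcoeffD mcoeffZ mcoeffUU mulr1 (mcoeff_outdom mNa).
  by rewrite addr0.
split=> // k ak; apply: mac; rewrite mcoeffD mcoeffZ mcoeffU1.
case: (m =P k) => [mk|_]; last by rewrite mulr0 add0r.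
by move: ak; rewrite mcoeff_neq0 -mk (negPf mNa).
Qed.

Lemma below_tgt u al v n : le (ins u v (lead al)) n ->
  below le n (ctx u v (ptgt al)).
Proof. by apply: below_le => //; apply: below_ctx. Qed.

(** Rewriting is not stable under addition in general, because a redex may also
    occur in the added term, with a coefficient that cancels it.  Here every
    word rewritten along the path is below [m], so the added term never
    interferes. *)
Lemma reduces_context c m x y : below le m x -> reduces x y ->
  reduces (c *: << m >> + x) (c *: << m >> + y).
Proof.
move=> + xy; move: x y xy; apply: reduces_ind => [x _|d u al v a z d0 kNa _ IH].
  exact: reduces_refl.
move=> /(below_redex d0 kNa)[km am]; rewrite [X in reduces X _]addrCA; apply: reduces_step.
  rewrite -mcoeff_eq0 mcoeffD mcoeffZ mcoeffU1 (mcoeff_outdom kNa) addr0.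
  have /andP[+ _] := km; rewrite eq_sym => /negPf->; by rewrite mulr0.
rewrite [X in reduces X _]addrCA; apply: IH; apply: supportedD => //; apply: supportedZ.
exact: below_tgt (lt_le km).
Qed.


Lemma reduces_tail m x z : supported (le^~ m) x ->
  reduces (x - x@_m *: << m >>) z -> reduces x (x@_m *: << m >> + z).
Proof.
move=> /below_tail xm /(reduces_context x@_m xm).
by rewrite -(leading_decomp m x).
Qed.

(** * Confluence from reducible leading monomials *)

Section Confluence.
Context (J : set A).
Hypothesis J_ideal : is_ideal J.
Hypothesis J_rule : forall al, J (psrc al - ptgt al).
Hypothesis J_lead : forall x, J x -> x != 0 -> reducible (lmon le x).

Lemma ideal_rule u al v : J (rule u al v).
Proof. by case: J_ideal => _ _ Jl Jr; rewrite /rule ctxE; apply/Jr/Jl/J_rule. Qed.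

(** When [m] does not occur in [x], this is [x] itself; this lets both sides of a
    congruence be reduced at the same word [m] without distinguishing cases. *)
Definition head_reduct u al v x : A :=
  let m := ins u v (lead al) in
  x@_m *: ctx u v (ptgt al) + (x - x@_m *: << m >>).

Lemma head_reductB u al v x :
  x - head_reduct u al v x = x@_(ins u v (lead al)) *: rule u al v.
Proof.
rewrite /head_reduct ruleE scalerBr; set b := _ *: _; set c := _ *: _.
by rewrite opprD opprB addrCA [x + _]addrC subrK addrC.
Qed.

Section HeadReduct.
Context (u v : M) (al : cells1 P) (x : A).
Local Notation m := (ins u v (lead al)).
Hypothesis xm : supported (le^~ m) x.

Lemma below_head_reduct : below le m (head_reduct u al v x).
Proof.
apply: supportedD; last exact: below_tail.
by apply: supportedZ; apply: below_tgt; apply: (mo_refl leP).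
Qed.

Lemma reduces_head z : reduces (head_reduct u al v x) z -> reduces x z.
Proof.
move=> hz; rewrite (leading_decomp m x); apply: reduces_step => //.
by rewrite -mcoeff_eq0; apply/eqP; exact: below_coeff (below_tail xm).
Qed.

End HeadReduct.

Definition joinable x y := exists2 z, reduces x z & reduces y z.

(** Well-founded induction on the bound [m].  Once both elements have been brought
    strictly below [m], a smaller bound is provided by the largest word that
    still occurs. *)
Lemma joinable_upto m x y : supported (le^~ m) x -> supported (le^~ m) y ->
  J (x - y) -> joinable x y.
Proof.
have [J0 JB Jl _] := J_ideal.
elim/(well_founded_ind (mo_wf leP)): m x y => m IH x y xm ym Jxy.
have low x' y' : below le m x' -> below le m y' -> J (x' - y') -> joinable x' y'.
  move=> x'm y'm; have [[-> ->]|[m' m'xy [x'm' y'm']]] := supported_max leP x' y'.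
    by exists 0; apply: reduces_refl.
  by apply: IH x'm' y'm'; case: m'xy => [/x'm|/y'm].
have [[u [al [v mE]]]|m_irr] := pselect (reducible m).
  (* Reducing at [m] changes the two elements by multiples of one rule. *)
  rewrite mE in xm ym low *; have JZ c : J (c *: rule u al v).
    by rewrite -mul_malgC; apply/Jl/ideal_rule.
  have [] := low (head_reduct u al v x) (head_reduct u al v y).
  - exact: below_head_reduct.
  - exact: below_head_reduct.
  - rewrite (subr_shift x y).
    by apply: (JB) => //; apply: (JB); rewrite head_reductB.
  - move=> z xz yz; exists z; first exact: (reduces_head xm xz).
    exact: (reduces_head ym yz).
(* An irreducible [m] with different coefficients in [x] and [y] would be the
   leading monomial of an element of [J]. *)
have xym : x@_m = y@_m.
  apply/eqP; rewrite -subr_eq0; apply: contra_notT m_irr => xy0.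
  rewrite -mcoeffB in xy0; have xy_le : supported (le^~ m) (x - y).
    exact: supportedB.
  rewrite -(lmon_eq leP xy0 xy_le); apply: J_lead => //.
  by apply: contraNneq xy0 => ->; rewrite mcoeff0.
have [] := low (x - x@_m *: << m >>) (y - y@_m *: << m >>).
- exact: below_tail.
- exact: below_tail.
- by rewrite xym opprB addrA subrK.
- move=> z xz yz; exists (x@_m *: << m >> + z); first exact: reduces_tail.
  by rewrite xym; apply: reduces_tail.
Qed.

Lemma joinable_ideal x y : J (x - y) -> joinable x y.
Proof.
have [[-> ->]|[m _ [xm ym]]] := supported_max leP x y; last exact: (joinable_upto xm ym).
by exists 0; apply: reduces_refl.
Qed.

(** The difference of the targets of two rules with the same source is the
    difference of the rules, hence lies in [J]. *)
Lemma critically_confluent_of_ideal : critically_confluent P.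
Proof.
move=> f g [[[u [al [v ->]]] [u' [be [v' ->]]]] fg _ _ _].
apply/confluentE/joinable_ideal; move: fg.
rewrite !cell_src_monomialE !cell_tgt_monomialE => fg.
have [_ JB _ _] := J_ideal.
have := JB _ _ (ideal_rule u' be v') (ideal_rule u al v).
by rewrite !ruleE fg opprB addrC addrA subrK.
Qed.

End Confluence.

(** * Leading monomials from critical confluence *)

(** For [D] the words below [m], this is the set of elements of the ideal having
    a representation by rules all of whose redexes are below [m].  Belonging to
    it says more than belonging to the ideal and being supported below [m]:
    high terms of a representation may cancel, and the criterion is precisely
    about avoiding such cancellations. *)
Inductive span (D : M -> Prop) : A -> Prop :=
| span0 : span D 0
| span_cons c u al v x : D (ins u v (lead al)) -> span D x ->
    span D (c *: rule u al v + x).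

Section SpanTheory.
Implicit Types (D : M -> Prop).

Lemma spanW D D' x : (forall k, D k -> D' k) -> span D x -> span D' x.
Proof.
by move=> DD'; elim=> [|c u al v y /DD' Dm _ IH]; [left | right].
Qed.

Lemma spanD D x y : span D x -> span D y -> span D (x + y).
Proof.
move=> Dx Dy; elim: Dx => [|c u al v z Dm _ IH]; first by rewrite add0r.
by rewrite -addrA; right.
Qed.

Lemma spanZ D c x : span D x -> span D (c *: x).
Proof.
elim=> [|d u al v y Dm _ IH]; first by rewrite scaler0; left.
by rewrite scalerDr scalerA; right.
Qed.

Lemma spanN D x : span D x -> span D (- x).
Proof. by rewrite -scaleN1r; apply: spanZ. Qed.

Lemma spanB D x y : span D x -> span D y -> span D (x - y).
Proof. by move=> Dx Dy; apply/spanD/spanN. Qed.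

Lemma span_rule D u al v : D (ins u v (lead al)) -> span D (rule u al v).
Proof.
move=> Dm; rewrite -[rule u al v]scale1r -[_ *: _]addr0.
by right=> //; left.
Qed.

Lemma ctx_rule w w' u al v :
  ctx w w' (rule u al v) = rule (mmul w u) al (mmul v w').
Proof. exact: ctx_ctx. Qed.

Lemma span_ctx D D' w w' x : (forall k, D k -> D' (ins w w' k)) ->
  span D x -> span D' (ctx w w' x).
Proof.
move=> DD'; elim=> [|c u al v y Dm _ IH]; first by rewrite linear0; left.
rewrite linearP /= ctx_rule; right=> //.
by rewrite -ins_ins; apply: DD'.
Qed.

Lemma span_linext D D' (h : M -> A) x : supported D x ->
  (forall k, D k -> span D' (h k)) -> span D' (linext h x).
Proof.
move=> Dx Dh; rewrite linext.unlock big_seq; apply: big_ind.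
- by left.
- exact: spanD.
- by move=> k; rewrite -mcoeff_neq0 => /Dx/Dh; apply: spanZ.
Qed.

Lemma span_mull D D' a x : supported D a ->
  (forall k, D k -> span D' (<< k >> * x)) -> span D' (a * x).
Proof.
by move=> Da Dx; rewrite -[a]linext_id freealg_mulr; apply: span_linext Dx.
Qed.

Lemma span_mulr D D' a x : supported D a ->
  (forall k, D k -> span D' (x * << k >>)) -> span D' (x * a).
Proof.
by move=> Da Dx; rewrite -[a]linext_id freealg_mull; apply: span_linext Dx.
Qed.

Lemma span_ideal : is_ideal (span (fun=> True)).
Proof.
split=> [|x y|a x Sx|a x Sx]; first exact: span0.
- exact: spanB.
- apply: (@span_mull (fun=> True)) => // k _.
  by rewrite -ctxl; apply: span_ctx Sx.
apply: (@span_mulr (fun=> True)) => // k _.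
by rewrite -ctxr; apply: span_ctx Sx.
Qed.

(** Only finitely many redexes are involved, so one of them bounds the others. *)
Lemma span_bound D x : span D x ->
  x = 0 \/ exists2 m, D m & span (le^~ m) x.
Proof.
elim=> [|c u al v y Dm Dy IH]; [by left | right].
have [y0|[m Dm' ym]] := IH.
  exists (ins u v (lead al)) => //; rewrite y0; right; last by left.
  exact: (mo_refl leP).
case/orP: (mo_total leP (ins u v (lead al)) m) => [km|mk].
  by exists m => //; right.
exists (ins u v (lead al)) => //; right; first exact: (mo_refl leP).
by apply: spanW ym => k km; apply: (mo_trans leP km).
Qed.

Lemma below_span m x : span (lt^~ m) x -> below le m x.
Proof.
elim=> [|c u al v y km _ IH]; first exact: supported0.
apply: supportedD => //; apply: supportedZ; rewrite ruleE; apply: supportedB.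
  exact: supportedU.
exact: below_tgt (lt_le km).
Qed.

Lemma span_reduces m x y : below le m x -> reduces x y ->
  below le m y /\ span (lt^~ m) (x - y).
Proof.
move=> + xy; move: x y xy; apply: reduces_ind => [x xm|c u al v a z c0 kNa _ IH].
  by split=> //; rewrite subrr; left.
move=> /(below_redex c0 kNa)[km am]; have [|zm Sz] := IH.
  by apply: supportedD => //; apply: supportedZ; apply: below_tgt (lt_le km).
split; first exact: zm.
have := span_cons c km Sz; rewrite ruleE scalerBr.
by rewrite [X in span _ X -> _]addr_telescope; apply.
Qed.

(** A word stands alone, so the first step of a nonempty path from it applies a
    rule to the whole word with coefficient 1; what follows happens below. *)
Lemma reduces_monomial m y : reduces << m >> y ->
  y = << m >> \/ exists u al v, m = ins u v (lead al) /\
    span (lt^~ m) (ctx u v (ptgt al) - y).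
Proof.
move=> my; pose Q x z := x = << m >> -> z = << m >> \/
  exists u al v, m = ins u v (lead al) /\
    span (lt^~ m) (ctx u v (ptgt al) - z).
have: Q << m >> y; last by apply.
apply: (reduces_ind (Q := Q) _ _ my) => [x ->|c u al v a z c0 kNa az _ mE].
  by left.
set k := ins u v (lead al) in kNa mE.
have ka : a@_k = 0 by apply: mcoeff_outdom.
have mk : m = k.
  apply/eqP; apply: contraNT c0 => mk.
  move: (congr1 (mcoeff k) mE); rewrite mcoeffD mcoeffZ mcoeffUU ka mcoeffU1.
  by rewrite (negPf mk) addr0 mulr1 => ->.
have c1 : c = 1.
  move: (congr1 (mcoeff k) mE); rewrite mcoeffD mcoeffZ mcoeffUU ka mk mcoeffUU.
  by rewrite addr0 mulr1.
have a0 : a = 0.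
  by move/eqP: mE; rewrite c1 mk scale1r -subr_eq0 addrAC subrr add0r => /eqP.
right; exists u, al, v; split=> //; move: az; rewrite c1 a0 scale1r addr0.
by move/span_reduces=> /(_ m)[] //; apply: below_tgt; rewrite mk; apply: (mo_refl leP).
Qed.

(** Each of the two disjoint rules is multiplied by the target of the other, whose
    words are smaller than its source; strict compatibility of the order with
    products then puts every redex below [m]. *)
Lemma peiffer_span m f g : is_peiffer f g -> cell_src f = << m >> ->
  span (lt^~ m) (cell_tgt f - cell_tgt g).
Proof.
move=> [_ [_ [[u [al [v ->]]] [u' [be [v' ->]]] fE gE]]].
set k := ins u v (lead al); set k' := ins u' v' (lead be).
have -> : cell_src f = << mmul k k' >>.
  by rewrite fE cell_src_r 2!cell_src_monomialE freealgUM.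
have -> : cell_tgt f = ctx u v (ptgt al) * << k' >>.
  by rewrite fE cell_tgt_r cell_src_monomialE cell_tgt_monomialE.
have -> : cell_tgt g = << k >> * ctx u' v' (ptgt be).
  by rewrite gE cell_tgt_l cell_src_monomialE cell_tgt_monomialE.
move=> /monomial_inj <-; rewrite peiffer_identity -2!ruleE.
have kt : below le k (ctx u v (ptgt al)) by apply/below_tgt/(mo_refl leP).
have k't : below le k' (ctx u' v' (ptgt be)) by apply/below_tgt/(mo_refl leP).
apply: spanB.
  apply: (span_mull kt) => j jk; rewrite -ctxl ctx_rule; apply: span_rule.
  by rewrite -ins_ins insl -[mmul j _]insr -[mmul k _]insr; apply: lt_ins.
apply: (span_mulr k't) => j jk'; rewrite -ctxr ctx_rule; apply: span_rule.
by rewrite -ins_ins insr -[mmul _ j]insl -[mmul _ k']insl; apply: lt_ins.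
Qed.

(** The inner cell of a whiskered 1-monomial is any positive cell, so it need not
    be a 1-monomial itself.  Its source is nevertheless a word, and it is not an
    identity, since the target of a rule avoids its source; hence it starts with
    a single rule and differs from it by terms below [m]. *)
Lemma whisker_monomial w w' u al v f : positive f ->
  monomial_cell u al v = whisker w f w' ->
  exists m, [/\ ins u v (lead al) = ins w w' m, cell_src f = << m >> &
    exists u' al' v', m = ins u' v' (lead al') /\
      span (lt^~ m) (ctx u' v' (ptgt al') - cell_tgt f)].
Proof.
move=> fp fE; have := congr1 (@cell_src K P) fE; have := congr1 (@cell_tgt K P) fE.
rewrite cell_src_monomialE cell_tgt_monomialE cell_src_whisker cell_tgt_whisker.
move=> ft /esym/ctx_eqU[m mE fs].
exists m; split=> //; have mf : reduces << m >> (cell_tgt f) by exists f.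
case: (reduces_monomial mf) => // ftm; exfalso.
have := below_coeff (below_tgt (mo_refl leP (ins u v (lead al)))).
by rewrite ft ftm ctxU mE mcoeffUU => /eqP; rewrite oner_eq0.
Qed.

Hypothesis critical : critically_confluent P.

(** Two rules applied to the same word have targets that agree up to rules applied
    strictly below.  The negation of each clause in the definition of a critical
    branching gives one case; whiskers decrease the length of the word, which
    the bound [n] records. *)
Lemma local_span n u al v u' be v' : (fdeg (ins u v (lead al)) < n)%N ->
  ins u v (lead al) = ins u' v' (lead be) ->
  span (lt^~ (ins u v (lead al))) (ctx u v (ptgt al) - ctx u' v' (ptgt be)).
Proof.
elim: n u al v u' be v' => // n IH u al v u' be v' size_m mE.
set m := ins u v (lead al).
pose f := monomial_cell u al v; pose g := monomial_cell u' be v'.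
have fs : cell_src f = << m >> by apply: cell_src_monomialE.
have gs : cell_src g = << m >> by rewrite cell_src_monomialE -mE.
rewrite -!cell_tgt_monomialE -/f -/g.
have [->|fNg] := pselect (f = g); first by rewrite subrr; left.
have [fg|Nfg] := pselect (is_peiffer f g); first exact: peiffer_span.
have [gf|Ngf] := pselect (is_peiffer g f).
  by rewrite -opprB; apply/spanN/peiffer_span.
have [wh|Nwh] := pselect (exists w w' f' g', [/\ ~ (w = mone /\ w' = mone),
    is_branching f' g', f = whisker w f' w' & g = whisker w g' w']); last first.
  have /confluentE[z fz gz] : confluent f g.
    apply: critical; split=> //; [|by rewrite fs gs|by case].
    by split; [exists u, al, v | exists u', be, v'].
  have mf : below le m (cell_tgt f).
    by rewrite cell_tgt_monomialE; apply/below_tgt/(mo_refl leP).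
  have mg : below le m (cell_tgt g).
    by rewrite cell_tgt_monomialE; apply: below_tgt; rewrite -mE; apply: (mo_refl leP).
  have [_ Sf] := span_reduces mf fz; have [_ Sg] := span_reduces mg gz.
  by have := spanB Sf Sg; rewrite [X in span _ X -> _]subrBB; apply.
case: wh => w [w' [f' [g' [w1 [fp gp fgs] fE gE]]]].
have [k [mk f'k [u1 [al1 [v1 [k1 S1]]]]]] := whisker_monomial fp fE.
have [k' [mk' g'k [u2 [al2 [v2 [k2 S2]]]]]] := whisker_monomial gp gE.
have kk' : k' = k by apply: (@monomial_inj K); rewrite /= -f'k -g'k fgs.
rewrite {}kk' in mk' g'k k2 S2.
have S12 : span (lt^~ k) (ctx u1 v1 (ptgt al1) - ctx u2 v2 (ptgt al2)).
  rewrite k1; apply: IH; rewrite -k1 //.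
  apply: leq_trans (fdeg_ins_lt k w1) _; rewrite -mk; exact: size_m.
have S : span (lt^~ k) (cell_tgt f' - cell_tgt g').
  by rewrite (subr_shift (ctx u1 v1 (ptgt al1)) (ctx u2 v2 (ptgt al2)));
    apply: spanB => //; apply: spanB.
have -> : cell_tgt f - cell_tgt g = ctx w w' (cell_tgt f' - cell_tgt g').
  rewrite linearB; congr (_ - _); first by rewrite fE; apply: cell_tgt_whisker.
  by rewrite gE; apply: cell_tgt_whisker.
apply: span_ctx S => j jk.
by rewrite /m mk; apply: lt_ins.
Qed.

(** All the terms whose redex is exactly [m] can be merged into one. *)
Lemma span_le_split m x : span (le^~ m) x ->
  exists2 y, span (lt^~ m) y & x = y \/
    exists c u al v, m = ins u v (lead al) /\ x = c *: rule u al v + y.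
Proof.
elim=> [|c u al v z km _ [y Sy IH]]; first by exists 0; [left | left].
have [mE|lt_km] := le_eqlt km; last first.
  exists (c *: rule u al v + y); first by right.
  case: IH => [->|[d [u' [be [v' [mE ->]]]]]]; [by left | right].
  by exists d, u', be, v'; split; [exact: mE | exact: addrCA].
case: IH => [->|[d [u' [be [v' [mE' ->]]]]]].
  by exists y => //; right; exists c, u, al, v.
exists (d *: (ctx u v (ptgt al) - ctx u' v' (ptgt be)) + y).
  apply: spanD => //; apply: spanZ; rewrite -mE.
  by apply: local_span (leqnn _) _; rewrite mE.
right; exists (c + d), u, al, v; split; first by [].
by rewrite 2!ruleE mE -mE'; apply: scaler_split.
Qed.

(** If the merged term at [m] vanishes, the bound [m] can be lowered; otherwise
    nothing else contributes to the coefficient of [m]. *)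
Lemma span_lmon m x : span (le^~ m) x -> x != 0 -> reducible (lmon le x).
Proof.
elim/(well_founded_ind (mo_wf leP)): m x => m IH x /span_le_split[y ym xy] x0.
have low : x = y -> reducible (lmon le x).
  move=> xyE; have Sx : span (lt^~ m) x by rewrite xyE.
  have [x_eq0|[m' m'm Sx']] := span_bound Sx; first by rewrite x_eq0 eqxx in x0.
  exact: IH Sx' x0.
case: xy => [//|[c [u [al [v [mE xE]]]]]].
have [c0|c0] := eqVneq c 0; first by apply: low; rewrite xE c0 scale0r add0r.
have ym' := below_span ym.
have tm : below le m (ctx u v (ptgt al)) by apply: below_tgt; rewrite mE; apply: (mo_refl leP).
exists u, al, v; rewrite -mE; apply: (lmon_eq leP).
  rewrite xE mcoeffD mcoeffZ (below_coeff ym') addr0 ruleE mcoeffB -mE mcoeffUU.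
  by rewrite (below_coeff tm) subr0 mulr1.
have lt_supp z : below le m z -> supported (le^~ m) z.
  by apply: supportedW => k; apply: lt_le.
rewrite xE; apply: supportedD; last exact: lt_supp.
apply: supportedZ; rewrite ruleE -mE; apply: supportedB; last exact: lt_supp.
by apply: supportedU; apply: (mo_refl leP).
Qed.

Lemma critically_confluent_lmon D x :
  span D x -> x != 0 -> reducible (lmon le x).
Proof.
by move=> /span_bound[->|[m _ /span_lmon]] //; rewrite eqxx.
Qed.

End SpanTheory.

End Oriented.

(** * The rules of a set of polynomials *)

Section LeadingRules.
Context (K : fieldType) (X : choiceType) (le : rel {fmonom X}).
Local Notation A := (freealg K X).
Hypothesis leP : is_monomial_order le.
Implicit Types (G : set A) (a x : A) (k : {fmonom X}).

Lemma ideal_genP G : is_ideal (ideal_gen G).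
Proof.
split=> [|x y Gx Gy|a x Gx|a x Gx] J JG; have [[J0 JB Jl Jr] _] := JG.
- exact: J0.
- by apply: JB; [apply: Gx | apply: Gy].
- by apply: Jl; apply: Gx.
- by apply: Jr; apply: Gx.
Qed.

Definition divisible_by_lead G k :=
  exists a u v, [/\ G a, a != 0 & k = ins u v (lmon le a)].

(** The elements supported by multiples of leading monomials of [G] form an ideal
    containing these leading monomials. *)
Lemma monomial_ideal G k : ideal_gen (lm le @` G) << k >> -> divisible_by_lead G k.
Proof.
pose J : set A := [set x | supported (divisible_by_lead G) x].
have sub w w' x : J x -> J (ctx w w' x).
  apply: supported_ctx => _ [a [u [v [Ga a0 ->]]]].
  by exists a, (mmul w u), (mmul v w'); split=> //; rewrite ins_ins.
have JP : is_ideal J.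
  split=> [|x y|a x Jx|a x Jx]; first exact: supported0.
  - exact: supportedB.
  - rewrite -[a]linext_id freealg_mulr /J /=; apply: supported_linext => j.
    by rewrite -ctxl; apply: sub.
  rewrite -[a]linext_id freealg_mull /J /=; apply: supported_linext => j.
  by rewrite -ctxr; apply: sub.
move=> Gk; suff: J << k >> by apply; rewrite mcoeffUU oner_eq0.
apply: Gk; split=> // _ [a Ga <-]; rewrite /lm; case: eqVneq => [_|a0].
  exact: supported0.
by apply: supportedU; exists a, mone, mone; rewrite ins1.
Qed.

Lemma groebner_basisP (I G : set A) : G `<=` I ->
  is_groebner_basis le I G <->
  (forall x, I x -> x != 0 -> divisible_by_lead G (lmon le x)).
Proof.
move=> GI; split=> [[_ IG] x Ix x0|div].
  apply: monomial_ideal; rewrite -IG; apply: sub_gen_smallest.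
  by exists x => //; rewrite /lm (negPf x0).
split=> //; apply/seteqP; split; apply: smallest_sub; try exact: ideal_genP.
  move=> _ [x Ix <-]; have [J0 _ Jl Jr] := ideal_genP (lm le @` G).
  rewrite /lm; case: eqVneq => // x0.
  have [a [u [v [Ga a0 ->]]]] := div x Ix x0.
  rewrite -ctxU ctxE; apply: (Jr); apply: (Jl); apply: sub_gen_smallest.
  by exists a => //; rewrite /lm (negPf a0).
by move=> _ [a Ga <-]; apply: sub_gen_smallest; exists a => //; apply: GI.
Qed.

Section Rules.
Context (G : set A).
Implicit Type (al : cells1 (Lead le G)).

Definition lead_word al : {fmonom X} := lmon le (val al).

Lemma lead_neq0 al : val al != 0.
Proof. by apply/eqP; have := set_mem (valP al) => -[]. Qed.

Lemma lead_mem al : G (val al).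
Proof. by have := set_mem (valP al) => -[]. Qed.

Lemma psrc_lead al : psrc al = << lead_word al >>.
Proof. by rewrite /= /lm (negPf (lead_neq0 al)). Qed.

Lemma lead_rule al : psrc al - ptgt al = (lc le (val al))^-1 *: val al.
Proof. by rewrite /= opprB addrC subrK. Qed.

Lemma ptgt_below al : below le (lead_word al) (ptgt al).
Proof.
have a0 := lead_neq0 al; have c0 := lc_neq0 le a0.
have -> : ptgt al = - (lc le (val al))^-1 *:
    (val al - (val al)@_(lead_word al) *: << lead_word al >>).
  by rewrite -psrc_lead; apply: scale_tail.
apply: supportedZ; apply: below_tail => k; exact: le_lmon.
Qed.

Lemma reducible_lead k : reducible lead_word k <-> divisible_by_lead G k.
Proof.
split=> [[u [al [v ->]]]|[a [u [v [Ga a0 ->]]]]].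
  by exists (val al), u, v; split=> //; [apply: lead_mem | apply: lead_neq0].
have aG : a \in G `\` [set 0] by apply/mem_set; split=> //; apply/eqP.
by exists u, (SigSub aG : cells1 (Lead le G)), v.
Qed.

Lemma span_lead a : G a -> span lead_word (fun=> True) a.
Proof.
have [-> _|a0 Ga] := eqVneq a 0; first exact: span0.
have aG : a \in G `\` [set 0] by apply/mem_set; split=> //; apply/eqP.
pose al := SigSub aG : cells1 (Lead le G).
have -> : a = lc le a *: rule mone al mone.
  rewrite /rule lead_rule ctxl [X in _ = _ *: X]mul1r scalerA.
  by rewrite mulfV ?scale1r // lc_neq0.
by apply: spanZ; apply: span_rule.
Qed.

End Rules.
End LeadingRules.

Theorem corollary4p2p3 (K : fieldType) (X : choiceType) (le : rel {fmonom X})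
    (I G : set (freealg K X)) (hle : is_monomial_order le) (hI : is_ideal I)
    (hG : G `<=` I) :
  (is_groebner_basis le I G -> critically_confluent (Lead le G)) /\
  (ideal_gen G = I -> critically_confluent (Lead le G) ->
   is_groebner_basis le I G).
Proof.
split=> [/(groebner_basisP le hG) div|GI cc].
  apply: (@critically_confluent_of_ideal K (Lead le G) le (@lead_word K X le G)
    hle (@psrc_lead K X le G) (@ptgt_below K X le hle G) I hI) => [al|x Ix x0].
    by rewrite lead_rule -mul_malgC; have [_ _ Il _] := hI; apply/Il; apply: hG;
      apply: lead_mem.
  by apply/reducible_lead/div.
apply/(groebner_basisP le hG) => x; rewrite -GI => Gx x0.
apply/reducible_lead; move: x0.
apply: (@critically_confluent_lmon K (Lead le G) le (@lead_word K X le G)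
  hle (@psrc_lead K X le G) (@ptgt_below K X le hle G) cc (fun=> True)).
apply: (@smallest_sub _ _ G _ (span_ideal (@lead_word K X le G)) _ _ Gx) => a.
exact: span_lead.
Qed.
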